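(* (1) $\mathbb{V}^{\mathsf R}_\Box$ and $\mathbb{V}^{\mathsf R}_\Diamond$ are semi-functors $\mathsf{KHaus}^{\mathsf R}\to\mathsf{KHaus}^{\mathsf R}$. (2) $\mathbb{V}^{\mathsf R}$ is an endofunctor on $\mathsf{KHaus}^{\mathsf R}$ which restricts to the Vietoris endofunctor $\mathbb{V}$ on $\mathsf{KHaus}$. (3) Each of $\mathbb{V}^{\mathsf R}_\Box$, $\mathbb{V}^{\mathsf R}_\Diamond$, $\mathbb{V}^{\mathsf R}$ restricts to $\mathsf{Stone}^{\mathsf R}$.
   Context: $\mathsf{KHaus}$ is the category of compact Hausdorff spaces and continuous functions. A relation $R\colon X\to Y$ (i.e. $R\subseteq X\times Y$) between compact Hausdorff spaces is closed if it is a closed subset of $X\times Y$. $\mathsf{KHaus}^{\mathsf R}$ is the category of compact Hausdorff spaces and closed relations, with identity relations as identities and relation composition ($x\,(R_2\circ R_1)\,z$ iff $\exists y$ with $x\,R_1\,y$ and $y\,R_2\,z$). Continuous functions are regarded as closed relations via their graphs. $\mathsf{Stone}^{\mathsf R}$ is the full subcategory of $\mathsf{KHaus}^{\mathsf R}$ consisting of Stone spaces. For a compact Hausdorff space $X$, the Vietoris space $\mathbb{V}(X)$ is the set of all closed subsets of $X$ (including $\varnothing$) with the topology generated by the subbasis of all $\Box_U=\{F\mid F\subseteq U\}$ and $\Diamond_U=\{F\mid F\cap U\neq\varnothing\}$, $U$ open in $X$. The Vietoris endofunctor $\mathbb{V}$ on $\mathsf{KHaus}$ sends $X$ to $\mathbb{V}(X)$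 and a continuous $f\colon X\to Y$ to the map $F\mapsto f[F]$. For a closed relation $R\colon X\to Y$ define relations from $\mathbb{V}(X)$ to $\mathbb{V}(Y)$: $F\,\mathcal{R}_\Box\,G$ iff $G\subseteq R[F]$; $F\,\mathcal{R}_\Diamond\,G$ iff $F\subseteq R^{-1}[G]$; $\mathcal{R}_{EM}=\mathcal{R}_\Box\cap\mathcal{R}_\Diamond$. The assignments $\mathbb{V}^{\mathsf R}_\Box,\mathbb{V}^{\mathsf R}_\Diamond,\mathbb{V}^{\mathsf R}$ all send an object $X$ to $\mathbb{V}(X)$, and send a closed relation $R$ to $\mathcal{R}_\Box$, $\mathcal{R}_\Diamond$, $\mathcal{R}_{EM}$ respectively. A semi-functor between categories assigns objects to objects and morphisms to morphisms (respecting domains and codomains) and preserves composition, but is not required to preserve identities. *)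

(* Defs.v *)
From HB Require Import structures.
From mathcomp Require Import all_boot finmap all_classical.
From mathcomp Require Import topology.

Set Implicit Arguments.
Unset Strict Implicit.
Unset Printing Implicit Defensive.

Local Open Scope classical_set_scope.

Record category := Category {
  obj :> Type;
  hom : obj -> obj -> Type;
  idm : forall A, hom A A;
  mcomp : forall A B C, hom B C -> hom A B -> hom A C;
  mcompA : forall A B C D (h : hom C D) (g : hom B C) (f : hom A B),
    mcomp h (mcomp g f) = mcomp (mcomp h g) f;
  mcompf1 : forall A B (f : hom A B), mcomp f (idm A) = f;
  mcomp1f : forall A B (f : hom A B), mcomp (idm B) f = f
}.
Arguments idm {c} A.

Record prefunctor (C D : category) := Prefunctor {
  fobj :> C -> D;
  fmor : forall A B, hom A B -> hom (fobj A) (fobj B)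
}.

Definition is_semifunctor (C D : category) (F : prefunctor C D) :=
  forall (A B E : C) (g : hom B E) (f : hom A B),
    fmor F (mcomp g f) = mcomp (fmor F g) (fmor F f).

Definition is_functor (C D : category) (F : prefunctor C D) :=
  is_semifunctor F /\ forall A : C, fmor F (idm A) = idm (F A).

Definition prefunctor_comp (C D E : category)
    (G : prefunctor D E) (F : prefunctor C D) : prefunctor C E :=
  @Prefunctor C E (fun A => G (F A)) (fun A B f => fmor G (fmor F f)).

Definition restricts_along (C C' : category) (I : prefunctor C' C)
    (F : prefunctor C C) (F' : prefunctor C' C') :=
  prefunctor_comp F I = prefunctor_comp I F'.

Section FullSubcategory.
Variables (C : category) (P : C -> Prop).

Definition full_subcategory : category :=
  @Category {A : C | P A} (fun A B => hom (sval A) (sval B))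
    (fun A => idm (sval A)) (fun A B E g f => mcomp g f)
    (fun A B E F h g f => mcompA h g f)
    (fun A B f => mcompf1 f) (fun A B f => mcomp1f f).

Definition full_inclusion : prefunctor full_subcategory C :=
  @Prefunctor full_subcategory C sval (fun A B f => f).

End FullSubcategory.

Record khaus := KHausSpace {
  kspace :> topologicalType;
  kcompact : compact [set: kspace];
  khausdorff : hausdorff_space kspace
}.

(* Zero-dimensionality in the sense that the clopen sets form a basis; for the
   library, [zero_dimensional] means that clopen sets separate points. *)
Definition stone (X : khaus) := basis (@clopen X).

Section KHausMaps.

Let khaus_compA (X Y Z W : khaus) (h : continuousType Z W)
    (g : continuousType Y Z) (f : continuousType X Y) :
  (h \o (g \o f : continuousType X Z) : continuousType X W) =
  ((h \o g : continuousType Y W) \o f : continuousType X W).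
Proof. exact/continuousEP. Qed.

Let khaus_compf1 (X Y : khaus) (f : continuousType X Y) :
  (f \o (@idfun X : continuousType X X) : continuousType X Y) = f.
Proof. exact/continuousEP. Qed.

Let khaus_comp1f (X Y : khaus) (f : continuousType X Y) :
  ((@idfun Y : continuousType Y Y) \o f : continuousType X Y) = f.
Proof. exact/continuousEP. Qed.

Definition KHaus : category :=
  @Category khaus (fun X Y => continuousType X Y)
    (fun X => @idfun X : continuousType X X)
    (fun X Y Z g f => g \o f : continuousType X Z)
    khaus_compA khaus_compf1 khaus_comp1f.

End KHausMaps.

Record closed_rel (X Y : topologicalType) := ClosedRel {
  crel :> set (X * Y);
  crel_closed : closed crel
}.

Lemma closed_relP (X Y : topologicalType) (R S : closed_rel X Y) :
  crel R = crel S -> R = S.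
Proof.
case: R S => [R cR] [S cS] /= eRS; case: _ / eRS cS => cS.
by congr ClosedRel; exact: Prop_irrelevance.
Qed.

Lemma closed_nearN (T : topologicalType) (A : set T) :
  (forall p, ~ A p -> \forall q \near p, ~ A q) -> closed A.
Proof. by move=> h p cp; apply: contrapT => /h /cp [q [Aq /(_ Aq)]]. Qed.

Lemma near_closedN (T : topologicalType) (A : set T) (p : T) :
  closed A -> ~ A p -> \forall q \near p, ~ A q.
Proof. by move=> cA nAp; apply: open_nbhs_nbhs; split=> //; exact: closed_openC. Qed.

Lemma hausdorff_sep (T : topologicalType) (x y : T) :
  hausdorff_space T -> x <> y ->
  exists A B : set T, [/\ open A, open B, A x, B y & A `&` B = set0].
Proof.
rewrite open_hausdorff => hT /eqP /hT.
move=> [[A B] /= [/set_mem Ax /set_mem By] [oA oB /eqP AB0]].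
by exists A, B.
Qed.

Lemma graph_closed (X : topologicalType) (Y : khaus) (f : X -> Y) :
  continuous f -> closed [set xy : X * Y | f xy.1 = xy.2].
Proof.
move=> cf; apply: closed_nearN => -[x y] /=.
move=> /(hausdorff_sep (@khausdorff Y)) [A [B [oA oB Afx By AB0]]].
exists (f @^-1` A, B); first split.
- by apply: cf; exact: open_nbhs_nbhs.
- exact: open_nbhs_nbhs.
move=> [x' y'] /= [Afx' By'] fx'y'; rewrite -fx'y' in By'.
by have : (A `&` B) (f x') by []; rewrite AB0.
Qed.

Lemma diagonal_closed (X : khaus) : closed (@diagonal X).
Proof. by apply: (@graph_closed X X idfun) => x. Qed.

Lemma rel_comp_closed (X Y Z : khaus) (S : closed_rel Y Z) (R : closed_rel X Y) :
  closed (crel S \; crel R)%relation.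
Proof.
apply: closed_nearN => -[x z] nSR.
have /compact_near_coveringP ncY := @kcompact Y.
have := @ncY (X * Z)%type (nbhs (x, z))
  (fun xz y => ~ (crel R (xz.1, y) /\ crel S (y, xz.2))) (nbhs_filter _).
have H : forall y, [set: Y] y -> \forall y' \near y & xz \near (x, z),
    ~ (crel R (xz.1, y') /\ crel S (y', xz.2)).
  move=> y _; have [Rxy|nRxy] := pselect (crel R (x, y)).
    have nSyz : ~ crel S (y, z) by move=> Syz; apply: nSR; exists y.
    have [[A B] /= [yA zB] AB] := near_closedN (crel_closed (c := S)) nSyz.
    exists (A, [set: X] `*` B) => /=.
      by split=> //; exists ([set: X], B) => //; split=> //; exact: filterT.
    by move=> [y' [x' z']] /= [Ay' [_ Bz']] [_]; exact: (AB (y', z')).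
  have [[A B] /= [xA yB] AB] := near_closedN (crel_closed (c := R)) nRxy.
  exists (B, A `*` [set: Z]) => /=.
    by split=> //; exists (A, [set: Z]) => //; split=> //; exact: filterT.
  by move=> [y' [x' z']] /= [By' [Ax' _]] [+ _]; exact: (AB (x', y')).
move=> /(_ H); apply: filterS => -[x' z'] /= h [y Rxy Syz].
exact: (h y I).
Qed.

Definition id_rel (X : khaus) : closed_rel X X := ClosedRel (@diagonal_closed X).

Definition comp_rel (X Y Z : khaus) (S : closed_rel Y Z) (R : closed_rel X Y) :
  closed_rel X Z := ClosedRel (@rel_comp_closed X Y Z S R).

Section KHausRelations.

Let comp_relA (X Y Z W : khaus) (T : closed_rel Z W)
    (S : closed_rel Y Z) (R : closed_rel X Y) :
  comp_rel T (comp_rel S R) = comp_rel (comp_rel T S) R.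
Proof.
apply: closed_relP; rewrite predeqE => -[x w] /=; split.
  by move=> [z [y Rxy Syz] Tzw]; exists y => //; exists z.
by move=> [y Rxy [z Syz Tzw]]; exists z => //; exists y.
Qed.

Let comp_rel1 (X Y : khaus) (R : closed_rel X Y) : comp_rel R (id_rel X) = R.
Proof.
apply: closed_relP; rewrite predeqE => -[x y] /=; split.
  by move=> [x' /diagonalP ->].
by exists x.
Qed.

Let comp_1rel (X Y : khaus) (R : closed_rel X Y) : comp_rel (id_rel Y) R = R.
Proof.
apply: closed_relP; rewrite predeqE => -[x y] /=; split.
  by move=> [y' + /diagonalP <-].
by exists y.
Qed.

Definition KHausR : category :=
  @Category khaus (fun X Y => closed_rel X Y) id_rel comp_rel
    comp_relA comp_rel1 comp_1rel.

End KHausRelations.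

Definition StoneR : category := full_subcategory (C := KHausR) stone.

Definition stone_inclusion : prefunctor StoneR KHausR :=
  full_inclusion (C := KHausR) stone.

Definition graph_rel (X Y : khaus) (f : continuousType X Y) : closed_rel X Y :=
  ClosedRel (graph_closed (@cts_fun _ _ f)).

Definition graph_functor : prefunctor KHaus KHausR :=
  @Prefunctor KHaus KHausR (fun X => X) graph_rel.

Lemma graph_functorP : is_functor graph_functor.
Proof.
split=> [X Y Z g f|X]; last exact: closed_relP.
apply: closed_relP; rewrite predeqE => -[x z] /=; split.
  by move=> <-; exists (f x).
by move=> [y <- <-].
Qed.

Record vietoris (X : topologicalType) := Vietoris {
  vset : set X;
  vset_closed : closed vset
}.

Lemma vietorisP (X : topologicalType) (F G : vietoris X) :
  vset F = vset G -> F = G.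
Proof.
case: F G => [F cF] [G cG] /= eFG; case: _ / eFG cG => cG.
by congr Vietoris; exact: Prop_irrelevance.
Qed.

Definition vbox (X : topologicalType) (U : set X) : set (vietoris X) :=
  [set F | vset F `<=` U].

Definition vdia (X : topologicalType) (U : set X) : set (vietoris X) :=
  [set F | vset F `&` U !=set0].

Definition vietoris_subbase (X : topologicalType) : set (set (vietoris X)) :=
  [set B | exists2 U : set X, open U & B = vbox U \/ B = vdia U].

HB.instance Definition _ (X : topologicalType) := gen_eqMixin (vietoris X).
HB.instance Definition _ (X : topologicalType) := gen_choiceMixin (vietoris X).
HB.instance Definition _ (X : topologicalType) :=
  @isSubBaseTopological.Build (vietoris X) (set (vietoris X))
    (@vietoris_subbase X) id.

Section VietorisTopology.
Variable X : topologicalType.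

Lemma vietoris_subbase_open (B : set (vietoris X)) :
  vietoris_subbase B -> open B.
Proof.
move=> sB; exists [set B]; last by rewrite bigcup_set1.
move=> _ ->; exists [fset B]%fset.
  by move=> i /fset1P ->; exact/mem_set.
by rewrite set_fset1 bigcap_set1.
Qed.

Lemma vbox_open (U : set X) : open U -> open (vbox U).
Proof. by move=> oU; apply: vietoris_subbase_open; exists U => //; left. Qed.

Lemma vdia_open (U : set X) : open U -> open (vdia U).
Proof. by move=> oU; apply: vietoris_subbase_open; exists U => //; right. Qed.

Lemma vietoris_cvg (F : set_system (vietoris X)) (K : vietoris X) : Filter F ->
  (forall U : set X, open U -> vset K `<=` U -> F (vbox U)) ->
  (forall U : set X, open U -> vset K `&` U !=set0 -> F (vdia U)) ->
  F --> K.
Proof.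
move=> FF hb hd A; rewrite nbhsE => -[B [[D sD <-] [C DC CK]] BA].
apply: filterS BA _; apply: (@filterS _ F _ C); first by move=> G CG; exists C.
have [E sE CE] := sD _ DC.
rewrite -CE in CK *; apply: filter_bigI => S ES.
have /set_mem [U oU [SU|SU]] := sE _ ES; have SK : S K by exact: CK.
  by rewrite SU in SK *; exact: hb.
by rewrite SU in SK *; exact: hd.
Qed.

End VietorisTopology.

Lemma vietoris_compact (X : khaus) : compact [set: vietoris X].
Proof.
rewrite compact_ultra => F FU _.
pose K := [set x : X | forall O : set X, open O -> O x -> F (vdia O)].
have NK (x : X) : ~ K x -> exists O : set X, [/\ open O, O x & F (~` vdia O)].
  move=> /existsNP [O /not_implyP [oO /not_implyP [Ox nF]]]; exists O; split=> //.
  by have [|//] := in_ultra_setVsetC (vdia O) FU.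
have cK : closed K.
  apply: closed_nearN => x /NK [O [oO Ox FO]].
  apply: (@filterS _ (nbhs x) _ O); last exact: open_nbhs_nbhs.
  move=> y Oy /(_ O oO Oy) FO'.
  by have [G [+]] := filter_ex (filterI FO FO').
exists (Vietoris cK); split=> //; apply: vietoris_cvg => U oU /=; last first.
  by move=> [x [Kx Ux]]; exact: Kx.
move=> KU; have /compact_near_coveringP ncX : compact (~` U).
  by apply: subclosed_compact (@kcompact X) _ => //; exact: open_closedC.
have := @ncX (vietoris X) F (fun G x => ~ vset G x) (@filter_filter _ _ (@ultra_proper _ F FU)).
have H : forall x, (~` U) x -> \forall x' \near x & G \near F, ~ vset G x'.
  move=> x nUx; have /NK [O [oO Ox FO]] : ~ K x by move=> /KU.
  exists (O, ~` vdia O); first by split=> //; exact: open_nbhs_nbhs.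
  by move=> [x' G] /= [Ox' nG] Gx'; apply: nG; exists x'.
move=> /(_ H); apply: filterS => G GU x Gx; apply: contrapT => nUx.
exact: (GU x).
Qed.

Lemma vietoris_hausdorff (X : khaus) : hausdorff_space (vietoris X).
Proof.
suff sep (F G : vietoris X) (x : X) : vset F x -> ~ vset G x ->
    exists A B : set (vietoris X), [/\ nbhs F A, nbhs G B & A `&` B = set0].
  move=> F G clFG; apply: vietorisP; rewrite predeqE => x; split=> [Fx|Gx];
  apply: contrapT => nx.
    have [A [B [FA GB AB0]]] := sep _ _ _ Fx nx.
    by have := clFG _ _ FA GB; rewrite AB0 => -[].
  have [A [B [GA FB AB0]]] := sep _ _ _ Gx nx.
  by have := clFG _ _ FB GA; rewrite setIC AB0 => -[].
move=> Fx nGx.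
have /(compact_regular (@khausdorff X) (@kcompact X) filterT) [O /= xO OG] :
  nbhs x (~` vset G) by exact: near_closedN (vset_closed (v := G)) nGx.
exists (vdia O°), (vbox (~` closure O)); split.
- apply: open_nbhs_nbhs; split; first exact: vdia_open (open_interior _).
  by exists x.
- apply: open_nbhs_nbhs; split.
    by apply: vbox_open; apply: closed_openC; exact: closed_closure.
  by move=> y Gy /OG.
rewrite -subset0 => H [[y [Hy /interior_subset Oy]] HO].
by apply: (HO y Hy); exact: subset_closure.
Qed.

Definition vietoris_khaus (X : khaus) : khaus :=
  KHausSpace (@vietoris_compact X) (@vietoris_hausdorff X).

Section VietorisMap.
Variables (X Y : khaus) (f : continuousType X Y).

Lemma image_closed (F : vietoris X) : closed (f @` vset F).
Proof.
apply: compact_closed; first exact: khausdorff.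
apply: continuous_compact; first exact/continuous_subspaceT/cts_fun.
by apply: subclosed_compact (@kcompact X) _ => //; exact: vset_closed.
Qed.

Definition vietoris_fun (F : vietoris X) : vietoris Y :=
  Vietoris (@image_closed F).

Lemma vietoris_fun_continuous : continuous vietoris_fun.
Proof.
move=> F; apply: vietoris_cvg => [|U oU /=|U oU /=].
- exact: (@fmap_filter _ _ vietoris_fun (nbhs F) (nbhs_filter F)).
- move=> FU; apply: (@filterS _ (nbhs F) _ (vbox (f @^-1` U))).
    by move=> G GU _ [x Gx <-]; exact: GU.
  apply: open_nbhs_nbhs; split; last by move=> x Fx; apply: FU; exists x.
  by apply/vbox_open/open_comp => // x _; exact: cts_fun.
- move=> [_ [[x Fx <-] Ufx]].
  apply: (@filterS _ (nbhs F) _ (vdia (f @^-1` U))).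
    by move=> G [z [Gz Ufz]]; exists (f z); split=> //; exists z.
  apply: open_nbhs_nbhs; split; last by exists x.
  by apply/vdia_open/open_comp => // z _; exact: cts_fun.
Qed.

Definition vietoris_map : continuousType (vietoris_khaus X) (vietoris_khaus Y) :=
  @mkcts (vietoris X) (vietoris Y) vietoris_fun vietoris_fun_continuous.

End VietorisMap.

Definition vietoris_functor : prefunctor KHaus KHaus :=
  @Prefunctor KHaus KHaus vietoris_khaus vietoris_map.

Lemma vietoris_functorP : is_functor vietoris_functor.
Proof.
split=> [X Y Z g f|X]; apply/continuousEP => F; apply: vietorisP => /=.
  by rewrite -image_comp.
exact: image_id.
Qed.

Definition rel_image (X Y : Type) (R : set (X * Y)) (F : set X) : set Y :=
  [set y | exists2 x, F x & R (x, y)].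

Section RelationLiftings.
Variables (X Y : topologicalType) (R : set (X * Y)).

Definition rel_box : set (vietoris X * vietoris Y) :=
  [set FG | vset FG.2 `<=` rel_image R (vset FG.1)].

Definition rel_dia : set (vietoris X * vietoris Y) :=
  [set FG | vset FG.1 `<=` rel_image (R^-1)%relation (vset FG.2)].

Definition rel_EM : set (vietoris X * vietoris Y) := rel_box `&` rel_dia.

End RelationLiftings.

(* The assignment X |-> vietoris X, R |-> L R; it takes values in KHausR
   provided that L R is closed whenever R is. *)
Definition vietoris_lift
    (L : forall X Y : khaus, closed_rel X Y -> set (vietoris X * vietoris Y))
    (L_closed : forall (X Y : khaus) (R : closed_rel X Y), closed (L X Y R)) :
    prefunctor KHausR KHausR :=
  @Prefunctor KHausR KHausR vietoris_khaus
    (fun X Y (R : closed_rel X Y) =>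
      ClosedRel (L_closed X Y R)
        : closed_rel (vietoris_khaus X) (vietoris_khaus Y)).

(* Main.v *)
Require Import Defs.
From mathcomp Require Import all_boot all_classical.
From mathcomp Require Import topology.

(** Everything rests on one fact about a closed relation [R] between compact
    Hausdorff spaces: the image [rel_image R F] of a closed set is closed, being
    the projection of a compact set ([rel_image_closed]).

    The image being closed, a point [y] outside it has an open neighbourhood
    whose closure still misses it, which separates pairs violating
    [G `<=` R[F]] by Vietoris-open sets; hence [rel_box R] is closed
    ([rel_box_closed]).  The relation [rel_dia R] is the converse of [rel_box]
    of the converse of [R], and [rel_EM R] is an intersection, so these are
    closed too.

    Composition is preserved because the required intermediate closed set can be
    written down.  When [F] is related to [H] by the lifting of [S \o R], take
    [R[F]] for the box lifting, the preimage of [H] under [S] for the diamond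
    lifting, and the intersection of the two for the Egli-Milner lifting; the
    last works since every path [x R y S z] with [x] in [F] and [z] in [H] has
    its midpoint in both.

    On identities, and more generally on graphs of functions, the box and
    diamond conditions are the two inclusions between [G] and [f @` F]; only
    their conjunction forces [G = f @` F], which is why the Egli-Milner lifting
    alone preserves identities and extends the Vietoris functor.

    Since Stone spaces form a full subcategory, restricting to them amounts to
    showing that [vietoris X] has a clopen basis when [X] has one.  For clopen
    [C], the sets [vbox C] and [vdia C] are complementary to subbasic sets,
    hence clopen; they suffice to generate the topology because a closed set,
    being compact, has a clopen neighbourhood inside any open set containing it
    ([stone_clopen_between]). *)

Set Implicit Arguments.
Unset Strict Implicit.
Unset Printing Implicit Defensive.

Local Open Scope classical_set_scope.

(** * Closed relations and their images *)

Lemma khaus_closed_compact (X : khaus) (A : set X) : closed A -> compact A.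
Proof.
by move=> cA; apply: subclosed_compact (@kcompact X) _.
Qed.

Lemma converse_rel_closed (X Y : topologicalType) (R : closed_rel X Y) :
  closed ((crel R)^-1)%relation.
Proof.
apply: (@closed_comp _ _ (fun yx : Y * X => (yx.2, yx.1)) (crel R));
  last exact: crel_closed.
by move=> yx _; exact: swap_continuous.
Qed.

Definition converse_rel (X Y : topologicalType) (R : closed_rel X Y) :
  closed_rel Y X := ClosedRel (@converse_rel_closed _ _ R).

Lemma rel_imageE (X Y : Type) (R : set (X * Y)) (F : set X) :
  rel_image R F = snd @` (R `&` F `*` [set: Y]).
Proof.
rewrite predeqE => y; split; first by move=> [x Fx Rxy]; exists (x, y).
by move=> [[x z] /= [Rxz [Fx _]] <-]; exists x.
Qed.

(** A projection of a compact set is compact, hence closed. *)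
Lemma rel_image_closed (X Y : khaus) (R : closed_rel X Y) (F : set X) :
  closed F -> closed (rel_image R F).
Proof.
move=> cF; rewrite rel_imageE; apply: compact_closed; first exact: khausdorff.
apply: continuous_compact.
  by apply: continuous_subspaceT => xy; exact: cvg_snd.
rewrite setIC; apply: compact_closedI; last exact: crel_closed.
by apply: compact_setX; [exact: khaus_closed_compact | exact: kcompact].
Qed.

Definition vietoris_image (X Y : khaus) (R : closed_rel X Y)
    (F : vietoris X) : vietoris Y :=
  Vietoris (@rel_image_closed _ _ R _ (vset_closed (v := F))).

Definition vietoris_inter (X : topologicalType) (F G : vietoris X) :
    vietoris X :=
  Vietoris (closedI (vset_closed (v := F)) (vset_closed (v := G))).

(** * The liftings are closed relations *)

(** If [y] in [G] lies outside [R[F]], pick a neighbourhood [O] of [y] whose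
    closure misses [R[F]]: no closed set avoiding the preimage of [closure O]
    can be related to a closed set meeting [O]. *)
Lemma rel_box_closed (X Y : khaus) (R : closed_rel X Y) : closed (rel_box R).
Proof.
apply: closed_nearN => -[F G] /= /existsNP [y /not_implyP [Gy nRFy]].
have /(compact_regular (@khausdorff Y) (@kcompact Y) filterT) [O /= yO ORF] :
    nbhs y (~` rel_image R (vset F)).
  exact: near_closedN (@rel_image_closed _ _ R _ (vset_closed (v := F))) nRFy.
pose U := ~` rel_image (converse_rel R) (closure O).
exists (vbox U, vdia O°); first split => /=.
- apply: open_nbhs_nbhs; split.
    apply/vbox_open/closed_openC; apply: rel_image_closed.
    exact: closed_closure.
  by move=> x Fx [y' /ORF nRFy' Rxy']; apply: nRFy'; exists x.
- apply: open_nbhs_nbhs; split; first exact/vdia_open/open_interior.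
  by exists y.
move=> [F' G'] /= [F'U [y' [G'y' /interior_subset Oy']]].
move=> /(_ _ G'y') [x F'x Rxy'].
by apply: (F'U x F'x); exists y' => //; exact: subset_closure.
Qed.

(** The diamond lifting is the box lifting with both relations reversed. *)
Lemma rel_dia_closed (X Y : khaus) (R : closed_rel X Y) : closed (rel_dia R).
Proof.
have cB := @rel_box_closed _ _ (converse_rel R).
exact: (@converse_rel_closed _ _ (ClosedRel cB)).
Qed.

Lemma rel_EM_closed (X Y : khaus) (R : closed_rel X Y) : closed (rel_EM R).
Proof. exact: closedI (@rel_box_closed _ _ R) (@rel_dia_closed _ _ R). Qed.

(** * Functoriality of the liftings *)

Lemma box_semifunctor : is_semifunctor (vietoris_lift rel_box_closed).
Proof.
move=> X Y Z S R; apply: closed_relP; rewrite predeqE => -[F H] /=; split.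
  move=> HSRF; exists (vietoris_image R F) => // z /HSRF [x Fx [y Rxy Syz]].
  by exists y => //; exists x.
move=> [G GRF HSG] z /HSG [y /GRF [x Fx Rxy] Syz].
by exists x => //; exists y.
Qed.

Lemma dia_semifunctor : is_semifunctor (vietoris_lift rel_dia_closed).
Proof.
move=> X Y Z S R; apply: closed_relP; rewrite predeqE => -[F H] /=; split.
  move=> FSRH; exists (vietoris_image (converse_rel S) H) => //.
  move=> x /FSRH [z Hz [y Rxy Syz]].
  by exists y => //; exists z.
move=> [G FRG GSH] x /FRG [y /GSH [z Hz Syz] Rxy].
by exists z => //; exists y.
Qed.

Lemma EM_semifunctor : is_semifunctor (vietoris_lift rel_EM_closed).
Proof.
move=> X Y Z S R; apply: closed_relP; rewrite predeqE => -[F H] /=; split.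
  move=> [/= HSRF FSRH].
  exists (vietoris_inter (vietoris_image R F)
                         (vietoris_image (converse_rel S) H)).
    split=> [y [] //|x Fx]; have [z Hz [y Rxy Syz]] := FSRH x Fx.
    by exists y => //; split; [exists x | exists z].
  split=> [z Hz|y [] //]; have [x Fx [y Rxy Syz]] := HSRF z Hz.
  by exists y => //; split; [exists x | exists z].
move=> [G [/= GRF FRG] [/= HSG GSH]]; split=> [z|x].
  by move=> /HSG [y /GRF [x Fx Rxy] Syz]; exists x => //; exists y.
by move=> /FRG [y /GSH [z Hz Syz] Rxy]; exists z => //; exists y.
Qed.

(** For the graph of [f], the box condition says [G `<=` f @` F] and the diamond
    condition says [f @` F `<=` G]. *)
Lemma rel_EM_graph (X Y : khaus) (f : continuousType X Y) :
  rel_EM (graph_rel f) = crel (graph_rel (vietoris_map f)).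
Proof.
rewrite predeqE => -[F G]; split.
  move=> [/= GfF FfG]; apply: vietorisP; rewrite predeqE => y; split.
    by move=> [x /FfG [y' Gy' /= fxy'] <-]; rewrite fxy'.
  by move=> /GfF [x Fx fxy]; exists x.
move=> /= <-; split=> [y [x Fx <-]|x Fx] /=; first by exists x.
by exists (f x) => //; exists x.
Qed.

Lemma EM_restricts_vietoris :
  restricts_along graph_functor (vietoris_lift rel_EM_closed) vietoris_functor.
Proof.
rewrite /restricts_along /prefunctor_comp /=; congr Prefunctor.
apply: functional_extensionality_dep => X.
apply: functional_extensionality_dep => Y.
apply: functional_extensionality_dep => f.
by apply: closed_relP; exact: rel_EM_graph.
Qed.

(** Identities are graphs, so this is an instance of [rel_EM_graph]. *)
Lemma EM_functor : is_functor (vietoris_lift rel_EM_closed).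
Proof.
split=> [|X]; first exact: EM_semifunctor.
have [_ graph1] := graph_functorP; have [_ vietoris1] := vietoris_functorP.
have -> : idm X = graph_rel (@idm KHaus X) :> closed_rel X X.
  by rewrite -(graph1 X).
rewrite -(graph1 (vietoris_khaus X)) -(vietoris1 X).
by apply: closed_relP; exact: rel_EM_graph.
Qed.

(** * Restriction to Stone spaces *)

(** Every point of [A] has a clopen neighbourhood inside [U], and finite unions
    of clopen sets are clopen.  Compactness enters as the near-covering property
    along the filter of clopen subsets of [U] ordered by inclusion. *)
Lemma stone_clopen_between (X : khaus) (A U : set X) :
  stone X -> closed A -> open U -> A `<=` U ->
  exists C : set X, [/\ clopen C, A `<=` C & C `<=` U].
Proof.
move=> [_ sX] cA oU AU.
pose inU := [set C : set X | clopen C /\ C `<=` U].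
pose above := filter_from inU (fun C => [set D | inU D /\ C `<=` D]).
have aboveF : ProperFilter above.
  apply: filter_from_proper; last by move=> C iC; exists C; split.
  apply: filter_from_filter; first by exists set0; split=> //; exact: clopen0.
  move=> C D [cC CU] [cD DU]; exists (C `|` D).
    by split; [exact: clopenU | rewrite subUset].
  by move=> E [iE]; rewrite subUset => -[CE DE]; split; split.
have /compact_near_coveringP ncA := khaus_closed_compact cA.
have := ncA (set X) above (fun C x => C x) (@filter_filter _ _ aboveF).
have H : forall x, A x -> \forall x' \near x & C \near above, C x'.
  move=> x Ax; have /sX [C [cC Cx] CU] : nbhs x U.
    by apply: open_nbhs_nbhs; split=> //; exact: AU.
  exists (C, [set D | inU D /\ C `<=` D]) => /=.
    split; last by exists C.
    by apply: open_nbhs_nbhs; split=> //; case: cC.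
  by move=> [x' D] /= [Cx' [_ CD]]; exact: CD.
move=> /(_ H) AC; have inUC : above inU.
  by exists set0; [split=> //; exact: clopen0 | move=> D []].
by have [C [/= AC' [cC CU]]] := filter_ex (filterI AC inUC); exists C.
Qed.

Lemma vboxC (X : topologicalType) (U : set X) : vbox (~` U) = ~` vdia U.
Proof.
rewrite predeqE => F; split=> [FU [x [Fx Ux]]|nF x Fx Ux]; first exact: FU Ux.
by apply: nF; exists x.
Qed.

Lemma vbox_clopen (X : topologicalType) (C : set X) :
  clopen C -> clopen (vbox C).
Proof.
move=> [oC cC]; split; first exact: vbox_open.
by rewrite -[C]setCK vboxC; apply/open_closedC/vdia_open/closed_openC.
Qed.

Lemma vdia_clopen (X : topologicalType) (C : set X) :
  clopen C -> clopen (vdia C).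
Proof.
move=> [oC cC]; split; first exact: vdia_open.
by rewrite -[vdia C]setCK -vboxC; apply/open_closedC/vbox_open/closed_openC.
Qed.

Lemma vietoris_stone (X : khaus) : stone X -> stone (vietoris_khaus X).
Proof.
move=> sX; split=> [B []//|K].
have nK : Filter (filter_from [set B | @clopen (vietoris X) B /\ B K] id).
  apply: filter_from_filter; first by exists setT; split=> //; exact: clopenT.
  move=> B D [cB BK] [cD DK]; exists (B `&` D) => //.
  by split=> //; exact: clopenI.
apply: vietoris_cvg => U oU.
  move=> /(stone_clopen_between sX (vset_closed (v := K)) oU) [C [cC KC CU]].
  exists (vbox C); first by split=> //; exact: vbox_clopen.
  by move=> F /= FC; exact: subset_trans FC CU.
move=> [x [Kx Ux]].
have /sX.2 [C [cC Cx] CU] : nbhs x U by exact: open_nbhs_nbhs.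
exists (vdia C); first by split; [exact: vdia_clopen | exists x].
by move=> F [y [Fy Cy]]; exists y; split=> //; exact: CU.
Qed.

Definition full_restriction (C : category) (P : C -> Prop) (F : prefunctor C C)
    (FP : forall A, P A -> P (F A)) :
    prefunctor (full_subcategory P) (full_subcategory P) :=
  @Prefunctor (full_subcategory P) (full_subcategory P)
    (fun A => exist _ (F (sval A)) (FP _ (svalP A)))
    (fun A B f => @fmor _ _ F (sval A) (sval B) f).

Lemma full_restriction_semifunctor (C : category) (P : C -> Prop)
    (F : prefunctor C C) (FP : forall A, P A -> P (F A)) :
  is_semifunctor F -> is_semifunctor (full_restriction FP).
Proof. by move=> sF A B E g f; exact: sF. Qed.

Lemma full_restriction_functor (C : category) (P : C -> Prop)
    (F : prefunctor C C) (FP : forall A, P A -> P (F A)) :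
  is_functor F -> is_functor (full_restriction FP).
Proof.
move=> [sF F1]; split; first exact: full_restriction_semifunctor.
by move=> A; exact: F1.
Qed.

Theorem theorem2p8 :
  exists (box_closed :
            forall (X Y : khaus) (R : closed_rel X Y), closed (rel_box R))
         (dia_closed :
            forall (X Y : khaus) (R : closed_rel X Y), closed (rel_dia R))
         (EM_closed :
            forall (X Y : khaus) (R : closed_rel X Y), closed (rel_EM R)),
  let Vbox : prefunctor KHausR KHausR := vietoris_lift box_closed in
  let Vdia : prefunctor KHausR KHausR := vietoris_lift dia_closed in
  let VR : prefunctor KHausR KHausR := vietoris_lift EM_closed in
  [/\ is_semifunctor Vbox /\ is_semifunctor Vdia,
      is_functor VR /\ restricts_along graph_functor VR vietoris_functor
    & [/\ exists G : prefunctor StoneR StoneR,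
            is_semifunctor G /\ restricts_along stone_inclusion Vbox G,
          exists G : prefunctor StoneR StoneR,
            is_semifunctor G /\ restricts_along stone_inclusion Vdia G
        & exists G : prefunctor StoneR StoneR,
            is_functor G /\ restricts_along stone_inclusion VR G]].
Proof.
exists rel_box_closed, rel_dia_closed, rel_EM_closed; split.
- by split; [exact: box_semifunctor | exact: dia_semifunctor].
- by split; [exact: EM_functor | exact: EM_restricts_vietoris].
split.
- exists (full_restriction (F := vietoris_lift rel_box_closed) vietoris_stone).
  by split=> //; exact: full_restriction_semifunctor box_semifunctor.
- exists (full_restriction (F := vietoris_lift rel_dia_closed) vietoris_stone).
  by split=> //; exact: full_restriction_semifunctor dia_semifunctor.
- exists (full_restriction (F := vietoris_lift rel_EM_closed) vietoris_stone).
  by split=> //; exact: full_restriction_functor EM_functor.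
Qed.
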